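(* Consider the random hypercube process $Q(0)\subset Q(1)\subset\dots\subset Q(nd/2)$ on $Q^d$, where $n=2^d$. Let $\tau_D$ be the hitting time of the property of having minimum degree at least one, and let $\tau_C$ be the hitting time of the property of being connected (as a spanning graph on $\{0,1\}^d$). Then with high probability $\tau_D=\tau_C$; that is, $\mathbb{P}[\tau_D=\tau_C]\to 1$ as $d\to\infty$.
   Context: The $d$-dimensional binary hypercube $Q^d$ is the graph with vertex set $V=\{0,1\}^d$ in which two vertices are adjacent if and only if they differ in exactly one coordinate. It is $d$-regular on $n:=2^d$ vertices and has $nd/2$ edges. The random hypercube process starts with $Q(0)$, the graph with no edges on the vertex set $\{0,1\}^d$. At each step $1\le i\le nd/2$, $Q(i)$ is obtained from $Q(i-1)$ by adding an edge of $Q^d$ chosen uniformly at random among the edges of $Q^d$ not yet present. (Equivalently, the edges of $Q^d$ are added one by one in a uniformly random order.) The hitting time of a monotone increasing, non-empty graph property $\mathcal{P}$ is the random variable equal to the index $\tau$ for which $Q(\tau)\in\mathcal{P}$ but $Q(\tau-1)\notin\mathcal{P}$. ''With high probability'' means with probability tending to one as $d\to\infty$. *)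

(* Defs.v *)
From mathcomp Require Import all_boot all_order all_algebra.
From mathcomp Require Import reals.

Set Implicit Arguments.
Unset Strict Implicit.
Unset Printing Implicit Defensive.

Import GRing.Theory.

Definition vertex (d : nat) := {ffun 'I_d -> bool}.

(* A spanning graph on [vertex d] is given by its set of edges, an edge being
   the unordered pair [set x; y] of its two endpoints. *)
Definition graph (d : nat) := {set {set vertex d}}.

Definition cube_adj (d : nat) (x y : vertex d) : bool :=
  #|[set i | x i != y i]| == 1.

Definition cube_edges (d : nat) : graph d :=
  [set e | [exists x, exists y, cube_adj x y && (e == [set x; y])]].

Definition adj (d : nat) (G : graph d) : rel (vertex d) :=
  fun x y => (x != y) && ([set x; y] \in G).

Definition degree (d : nat) (G : graph d) (x : vertex d) : nat :=
  #|[set y | adj G x y]|.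

Definition min_degree (d : nat) (G : graph d) : nat :=
  degree G [arg min_(x < [ffun=> false]) degree G x].

Lemma leq_min_degree (d : nat) (G : graph d) (k : nat) :
  (k <= min_degree G) = [forall x, k <= degree G x].
Proof.
rewrite /min_degree; case: arg_minnP => // x _ xmin.
by apply/idP/forallP => [kx y|/(_ x)//]; exact: leq_trans (xmin y isT).
Qed.

Definition connected (d : nat) (G : graph d) : bool :=
  [forall x, forall y, connect (adj G) x y].

(* nd/2 with n = 2^d *)
Definition nsteps (d : nat) : nat := (2 ^ d * d) %/ 2.

(* A trajectory of the process, recorded as the sequence of the edges chosen at
   steps 1, ..., nd/2 (the item of index i is the edge chosen at step i + 1). *)
Definition trajectory (d : nat) := (nsteps d).-tuple {set vertex d}.

(* The graph Q(i), for 0 <= i <= nd/2. *)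
Definition Q (d : nat) (w : trajectory d) (i : nat) : graph d :=
  [set e in take i w].

(* Given the graph G = Q(i), the probability that the edge e is chosen at step
   i + 1: e is uniform among the edges of the hypercube not yet present. *)
Definition step_law (R : realType) (d : nat) (G : graph d) (e : {set vertex d})
    : R :=
  if e \in cube_edges d :\: G then (#|cube_edges d :\: G|%:R^-1)%R else 0%R.

(* The law of the process (chain rule). *)
Definition process_law (R : realType) (d : nat) (w : trajectory d) : R :=
  (\prod_(i < nsteps d) step_law R (Q w i) (tnth w i))%R.

Definition Pr (R : realType) (d : nat) (A : pred (trajectory d)) : R :=
  (\sum_(w | A w) process_law R w)%R.

(* The index t such that Q(t) satisfies the property but Q(t - 1) does not, with
   t = 0 when already Q(0) satisfies it; see [hitting_timeP]. (If no Q(t) with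
   t <= nd/2 satisfies the property, the value is nd/2 + 1.) *)
Definition hitting_time (d : nat) (prop : graph d -> bool) (w : trajectory d)
    : nat :=
  find (fun t => prop (Q w t) && ((0 < t) ==> ~~ prop (Q w t.-1)))
       (iota 0 (nsteps d).+1).

Definition tau_D (d : nat) (w : trajectory d) : nat :=
  hitting_time (fun G : graph d => 1 <= min_degree G) w.

Definition tau_C (d : nat) (w : trajectory d) : nat :=
  hitting_time (@connected d) w.

Lemma hitting_timeP (d : nat) (prop : graph d -> bool) (w : trajectory d)
    (t : nat) :
  (forall G H : graph d, G \subset H -> prop G -> prop H) ->
  t <= nsteps d -> prop (Q w t) -> (0 < t -> ~~ prop (Q w t.-1)) ->
  hitting_time prop w = t.
Proof.
move=> mono tm pt npt; rewrite /hitting_time.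
have monoQ i j : i <= j -> prop (Q w i) -> prop (Q w j).
  move=> ij; apply: mono; apply/subsetP => e; rewrite !inE => ew.
  by rewrite -(subnKC ij) takeD mem_cat ew.
set a := (X in find X _).
have at_ : a t by rewrite /a pt; apply/implyP.
have nat_ s : s < t -> ~~ a s.
  move=> st; have t0 : 0 < t by apply: leq_ltn_trans st.
  have st1 : s <= t.-1 by rewrite -ltnS prednK.
  by rewrite negb_and (contra (monoQ _ _ st1) (npt t0)).
rewrite -(subnKC (leqW tm : t <= (nsteps d).+1)) iotaD find_cat.
rewrite ifN; last first.
  by apply/hasPn => s; rewrite mem_iota => /andP[_]; exact: nat_.
rewrite size_iota add0n subSn //= at_.
by rewrite addn0.
Qed.

Lemma card_cube_edges (d : nat) : #|cube_edges d| = nsteps d.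
Proof.
pose flip (x : vertex d) (i : 'I_d) : vertex d :=
  [ffun j => if j == i then ~~ x j else x j].
have flip_neq x i : flip x i != x.
  by apply/eqP => /ffunP/(_ i); rewrite ffunE eqxx; case: (x i).
have flip_inj x : injective (flip x).
  move=> i j /ffunP/(_ i); rewrite !ffunE eqxx; case: eqP => // _.
  by case: (x i).
have adj_flip x i : cube_adj x (flip x i).
  apply/cards1P; exists i; apply/setP => j; rewrite !inE ffunE.
  by case: (j == i); case: (x j).
have flipP x y : cube_adj x y -> exists i, y = flip x i.
  move=> /cards1P[i xyi]; exists i; apply/ffunP => j; rewrite ffunE.
  have := congr1 (fun A : {set _} => j \in A) xyi; rewrite !inE => <-.
  by case: (x j) (y j) => [] [].
have adjC x y : cube_adj x y = cube_adj y x.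
  by congr (_ == _); apply: eq_card => i; rewrite !inE eq_sym.
have deg x : #|[set e in cube_edges d | x \in e]| = d.
  have inj : injective (fun i => [set x; flip x i]).
    move=> i j /setP/(_ (flip x i)); rewrite !inE eqxx orbT (negbTE (flip_neq x i)) /=.
    by move/esym/eqP/flip_inj.
  rewrite -[RHS]card_ord -(card_imset _ inj); apply: eq_card => e.
  rewrite inE; apply/andP/imsetP => [[]|[i _ ->]].
    rewrite inE => /existsP[y /existsP[z /andP[yz /eqP->]]] /set2P[] ?; subst x.
      by have [i ->] := flipP _ _ yz; exists i.
    by move: yz; rewrite adjC => /flipP[i ->]; exists i; rewrite // setUC.
  split; last by rewrite set21.
  rewrite inE; apply/existsP; exists x; apply/existsP; exists (flip x i).
  by rewrite adj_flip eqxx.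
have : \sum_(x : vertex d) #|[set e in cube_edges d | x \in e]| = #|cube_edges d| * 2.
  under eq_bigr => x _ do rewrite -sum1dep_card.
  rewrite (exchange_big_dep (mem (cube_edges d))) /=; last by move=> x e _ /andP[].
  rewrite -sum_nat_const; apply: eq_bigr => e eE.
  rewrite sum1dep_card -[RHS]/(1.+1).
  move: (eE); rewrite inE => /existsP[x /existsP[y /andP[xy /eqP exy]]].
  have [i yi] := flipP _ _ xy.
  transitivity #|e|; first by apply: eq_card => z; move: eE; rewrite !in_set => ->.
  by rewrite exy cards2 yi eq_sym flip_neq.
under eq_bigr => x _ do rewrite deg.
rewrite sum_nat_const card_ffun card_bool card_ord /nsteps => ->.
by rewrite mulnK.
Qed.

Lemma Pr_total (R : realType) (d : nat) : Pr R (fun _ : trajectory d => true) = 1%R.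
Proof.
set m := nsteps d; set E := cube_edges d.
have law w : process_law R w =
    (if all (mem E) (w : trajectory d) && uniq w then (m`!%:R)^-1 else 0)%R.
  rewrite /process_law; case: ifPn => [/andP[/allP wE uw]|nw].
    have step (i : 'I_m) : step_law R (Q w i) (tnth w i) = ((m - i)%:R^-1)%R.
      have Qsub : Q w i \subset E.
        by apply/subsetP => e; rewrite inE => /mem_take; exact: wE.
      have cQ : #|Q w i| = i.
        rewrite cardsE (card_uniqP _) ?take_uniq // size_takel //.
        by rewrite size_tuple ltnW.
      rewrite /step_law cardsD (setIidPr Qsub) cQ card_cube_edges.
      rewrite inE [tnth w i \in E]wE ?mem_tnth // andbT ifT //.
      rewrite inE (tnth_nth set0) in_take_leq ?size_tuple ?(ltnW (ltn_ord i)) //.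
      by rewrite index_uniq ?size_tuple // ltnn.
    under eq_bigr => i _ do rewrite step.
    rewrite prodfV -natr_prod fact_prod; congr (_ %:R^-1)%R.
    rewrite (reindex_inj rev_ord_inj) /= big_add1 /= big_mkord.
    by apply: eq_bigr => i _; rewrite subnA ?subnn ?add0n.
  have [i bad] : exists i : 'I_m, tnth w i \notin E :\: Q w i.
    apply/existsP; apply: contraNT nw => /existsPn good.
    have {}good i : tnth w i \in E :\: Q w i by rewrite -[_ \in _]negbK good.
    apply/andP; split.
      by apply/allP => e /tnthP[i ->]; have := good i; rewrite inE => /andP[].
    apply/(uniqPn set0) => -[i [j [ij]]]; rewrite size_tuple => jm eij.
    have := good (Ordinal jm); rewrite !inE (tnth_nth set0) /= -eij => /andP[/negP[]].
    rewrite in_take_leq ?size_tuple ?(ltnW jm) //.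
    by apply: (leq_ltn_trans _ ij); rewrite index_nth // size_tuple (ltn_trans ij).
  by rewrite (bigD1 i) //= /step_law (negbTE bad) mul0r.
rewrite /Pr; under eq_bigr => w _ do rewrite law.
rewrite -big_mkcond /= sumr_const.
have -> : #|[pred w : trajectory d | all (mem E) w && uniq w]| = m`!.
  by rewrite -cardsE card_uniq_tuples card_cube_edges ffactnn.
rewrite -[(_ *+ _)%R]mulr_natr mulVf // Num.Theory.pnatr_eq0 -lt0n.
exact: fact_gt0.
Qed.

(* Main.v *)
Require Import Defs.
From mathcomp Require Import all_boot all_order all_algebra.
From mathcomp Require Import reals.
From mathcomp Require Import zify ring lra.

(** Write [N] for the number of edges of the cube.  A graph with an isolated
    vertex is not connected, so the two hitting times differ only when some
    [Q t] has no isolated vertex and is still disconnected.  Such a graph has a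
    component [D] with at least two and at most half of the vertices, and no
    edge of [Q t] leaves [D].  The proof rules such a [D] out by looking at the
    two fixed times [m1 = 3N/8] and [m0 = 7N/16].

    Up to time [m0] there is an isolated vertex: each vertex is isolated at
    time [m0] with probability about [(9/16)^d], which beats [2^-d], and a
    second moment computation concludes ([Pr_no_isolated]).  So only the times
    [t >= m0] matter, and no edge of [Q m1] or of [Q m0] leaves [D].

    A set of [k <= 2^i] vertices has at least [k(d - i)] edges leaving it
    ([isoperimetry]), and all of them are missing at time [m1] with probability
    at most [(5/8)^(k(d - i))].  With [q = d/3], this gives two regimes.

    Small sets, [2 <= k <= 2^(d - q)].  A connected set of [k] vertices is the
    trace of a walk of length [2(k - 1)], so there are at most
    [2^d d^(2(k - 1))] of them.  The union bound succeeds because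
    [2 (5/8)^2 < 1] settles bounded [k], while for larger [k] the factor
    [(d^2 (5/8)^q)^k] overwhelms [2^d] ([Pr_small_cut]).

    Large sets, [2^(d - q) <= k <= 2^(d - 1)].  There are too many connected
    sets for this bound, but [D] is a union of components of [Q m1].
    Those are isolated vertices, of which there are likely to be fewer than
    [2^q] by Markov's inequality as [2 (5/8) < 2^(1/3)], or have more than [2^(d - q)] vertices,
    hence number at most [2^q].  So given [Q m1] there are at most
    [2^(2 * 2^q)] candidates, each with at least [2^(d - q) >= 4^q] leaving
    edges, all of which have to be avoided between times [m1] and [m0]; this has
    probability at most [(9/10)^(4^q)] ([Pr_large_cut]).

    For large [d], every error term is at most a constant times
    [(125/128)^q]. *)

Set Implicit Arguments.
Unset Strict Implicit.
Unset Printing Implicit Defensive.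
Import Order.TTheory GRing.Theory Num.Theory.

(** * Edge isoperimetry in the cube *)

(** The inequality [H(t) >= 2t] for the binary entropy and [t <= 1/2], freed of
    logarithms; it follows from [(a + b)^2 >= 4ab], raised to the power [b]. *)
Lemma entropy_step a b : b <= a ->
  4 ^ b * (a ^ a * b ^ b) <= (a + b) ^ (a + b).
Proof.
move=> ba; have {2}-> : a + b = (2 * b) + (a - b) by lia.
rewrite expnD expnM -{2}(subnKC ba) expnD.
rewrite (_ : 4 ^ b * _ = (4 * a * b) ^ b * a ^ (a - b)); last first.
  by rewrite !expnMn; nia.
have le x y e : x <= y -> x ^ e <= y ^ e.
  by case: e => // e xy; rewrite leq_exp2r.
apply: leq_mul; apply: le; last exact: leq_addr.
by rewrite -mulnn; nia.
Qed.

Section Cube.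
Variable d : nat.
Implicit Types (x y z : vertex d) (i j : 'I_d) (S : {set vertex d}).

Definition flip x i : vertex d := [ffun j => (j == i) (+) x j].

Lemma flipK i : involutive (flip^~ i).
Proof. by move=> x; apply/ffunP => j; rewrite !ffunE addKb. Qed.

Lemma flip_neq x i : flip x i != x.
Proof. by apply/eqP => /ffunP/(_ i); rewrite ffunE eqxx; case: (x i). Qed.

Lemma flip_inj x : injective (flip x).
Proof.
move=> i j /ffunP/(_ i); rewrite !ffunE eqxx; case: eqP => // _.
by case: (x i).
Qed.

Lemma cube_adjP x y : reflect (exists i, y = flip x i) (cube_adj x y).
Proof.
apply: (iffP cards1P) => -[i].
  move=> xyi; exists i; apply/ffunP => j; rewrite ffunE.
  by have /setP/(_ j) := xyi; rewrite !inE => <-; case: (x j) (y j) => [] [].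
move=> ->; exists i; apply/setP => j; rewrite !inE ffunE.
by case: (j == i); case: (x j).
Qed.

Lemma cube_edgesP (e : {set vertex d}) :
  reflect (exists x i, e = [set x; flip x i]) (e \in cube_edges d).
Proof.
rewrite inE; apply: (iffP existsP) => -[x].
  by case/existsP => y /andP[/cube_adjP[i ->] /eqP->]; exists x, i.
case=> i ->; exists x; apply/existsP; exists (flip x i).
by rewrite eqxx andbT; apply/cube_adjP; exists i.
Qed.

Lemma flip_edge x y i : [set x; y] = [set x; flip x i] -> y = flip x i.
Proof.
move=> /setP/(_ (flip x i)); rewrite !inE eqxx orbT (negbTE (flip_neq x i)).
by move/eqP.
Qed.

Lemma set2_flip x y : [set x; y] \in cube_edges d -> exists i, y = flip x i.
Proof.
case/cube_edgesP => z [i e].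
have : x \in [set z; flip z i] by rewrite -e set21.
case/set2P=> xz; subst x; first by exists i; exact: flip_edge.
by exists i; apply: flip_edge; rewrite e flipK setUC.
Qed.

(** The edges meeting [S] are counted through pairs of a vertex of [S] and a
    coordinate, so that an edge inside [S] is counted twice by [inward]. *)
Definition inward S :=
  [set p : vertex d * 'I_d | (p.1 \in S) && (flip p.1 p.2 \in S)].
Definition outward S :=
  [set p : vertex d * 'I_d | (p.1 \in S) && (flip p.1 p.2 \notin S)].
Definition boundary S : graph d :=
  [set [set p.1; flip p.1 p.2] | p in outward S].

Lemma card_boundary S : #|boundary S| = #|outward S|.
Proof.
apply: card_in_imset => -[x i] [y j].
rewrite !inE /= => /andP[xS fxS] /andP[yS fyS] e.
have : x \in [set y; flip y j] by rewrite -e set21.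
case/set2P => xy; last by rewrite -xy xS in fyS.
by subst y; rewrite (flip_inj (flip_edge e)).
Qed.

Lemma boundary_sub S : boundary S \subset cube_edges d.
Proof.
by apply/subsetP => e /imsetP[p _ ->]; apply/cube_edgesP; exists p.1, p.2.
Qed.

Lemma card_inward_outward S : #|inward S| + #|outward S| = #|S| * d.
Proof.
transitivity #|setX S [set: 'I_d]|; last by rewrite cardsX cardsT card_ord.
rewrite -(cardsID [set p | flip p.1 p.2 \in S] (setX _ _)).
by congr (_ + _); apply: eq_card => p; rewrite !inE ?andbT // andbC.
Qed.

(** Cutting [S] along a coordinate only loses the edges in that direction, and
    these form a matching between the two halves. *)
Lemma inward_split S i (A := S :&: [set x : vertex d | x i])
    (B := S :\: [set x : vertex d | x i]) :
  #|inward S| <= #|inward A| + #|inward B| + 2 * minn #|A| #|B|.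
Proof.
pose cross := [set p in inward S | p.2 == i].
have sub : inward S \subset inward A :|: inward B :|: (cross :&: setX A [set i])
   :|: (cross :&: setX B [set i]).
  apply/subsetP => -[x k]; rewrite !inE /= !ffunE => /andP[xS kS].
  by rewrite xS kS /= (eq_sym i); case: eqP; case: (x i) => //=; rewrite ?orbT.
have crossE x k :
    ((x, k) \in cross) = [&& x \in S, flip x k \in S & k == i].
  by rewrite !inE andbA.
have cross_le (C D : {set vertex d}) :
    (forall x, x \in C -> flip x i \in S -> flip x i \in D) ->
    #|cross :&: setX C [set i]| <= #|D|.
  move=> CD.
  have inj : {in cross :&: setX C [set i] &,
      injective (fun p => flip p.1 p.2)}.
    case=> x k [y l]; rewrite !inE /= => /and3P[_ _ /eqP->] /and3P[_ _ /eqP->].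
    by move=> e; congr (_, _); rewrite -(flipK i x) e flipK.
  rewrite -(card_in_imset inj); apply: subset_leq_card; apply/subsetP => y.
  case/imsetP => -[x k]; rewrite in_setI crossE in_setX in_set1 /=.
  by move=> /and3P[/and3P[_ kS /eqP ki] xC _] ->; subst k; apply: CD.
have cross_min : forall C, C \in [:: A; B] ->
    #|cross :&: setX C [set i]| <= minn #|A| #|B|.
  move=> C; rewrite !inE => /orP[] /eqP->; rewrite leq_min; apply/andP; split.
  - by rewrite -[#|A|]muln1 -(cards1 i) -cardsX; exact/subset_leq_card/subsetIr.
  - by apply: cross_le => x; rewrite !inE !ffunE eqxx => /andP[_ ->] ->.
  - by apply: cross_le => x; rewrite !inE !ffunE eqxx => /andP[/negbTE-> _] ->.
  - by rewrite -[#|B|]muln1 -(cards1 i) -cardsX; exact/subset_leq_card/subsetIr.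
have cA := cross_min A; have cB := cross_min B.
rewrite !inE !eqxx orbT in cA cB.
apply: leq_trans (subset_leq_card sub) _.
have cU (C D : {set vertex d * 'I_d}) : #|C :|: D| <= #|C| + #|D|.
  by have [] := leq_card_setU C D.
rewrite mul2n -addnn addnA; apply: leq_trans (cU _ _) (leq_add _ (cB isT)).
by apply: leq_trans (cU _ _) (leq_add (cU _ _) (cA isT)).
Qed.

(** Induced subgraphs on [k] vertices have average degree at most [log2 k]; the
    exponential form keeps the induction in the natural numbers. *)
Lemma inward_bound S : 2 ^ #|inward S| <= #|S| ^ #|S|.
Proof.
have [n] := ubnP #|S|; elim: n S => // n IH S; rewrite ltnS => Sn.
have [S1|S2] := leqP #|S| 1.
  suff -> : inward S = set0 by rewrite cards0; case: #|S| S1 => [|[]].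
  apply/setP => -[x i]; rewrite !inE /=; apply/negP => /andP[xS fS].
  have /card_le1P/(_ _ xS)/(_ (flip x i)) := S1.
  by rewrite fS inE (negbTE (flip_neq x i)).
have [x [y [xS yS xy]]] := card_gt1P S2.
have /existsP[i xyi] : [exists i, x i != y i].
  apply: contraNT xy => /existsPn H; apply/eqP/ffunP => i; apply/eqP.
  by rewrite -[_ == _]negbK.
have := inward_split S i.
set A := _ :&: _; set B := _ :\: _ => spl.
have AB : #|A| + #|B| = #|S| by rewrite cardsID.
have A0 : 0 < #|A|.
  apply/card_gt0P.
  case xi: (x i); [exists x|exists y]; rewrite !inE ?xS ?yS ?xi //=.
  by move: xyi; rewrite xi; case: (y i).
have B0 : 0 < #|B|.
  apply/card_gt0P.
  case xi: (x i); [exists y|exists x]; rewrite !inE ?xS ?yS ?xi //=.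
  by move: xyi; rewrite xi; case: (y i).
have IA : 2 ^ #|inward A| <= #|A| ^ #|A| by apply: IH; lia.
have IB : 2 ^ #|inward B| <= #|B| ^ #|B| by apply: IH; lia.
apply: (@leq_trans (4 ^ minn #|A| #|B| * (#|A| ^ #|A| * #|B| ^ #|B|))).
  apply: leq_trans (leq_pexp2l _ spl) _ => //.
  by rewrite expnD expnM expnD mulnC leq_mul // leq_mul.
rewrite -AB; have [AB'|/ltnW AB'] := leqP #|A| #|B|.
  by rewrite [_ ^ _ * _ ^ _]mulnC [_ + _]addnC; exact: entropy_step.
exact: entropy_step.
Qed.

Lemma isoperimetry S k : #|S| <= 2 ^ k -> #|S| * (d - k) <= #|boundary S|.
Proof.
move=> Sk; have := card_inward_outward S; rewrite card_boundary.
have : #|inward S| <= k * #|S|.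
  rewrite -(@leq_exp2l 2) //; apply: leq_trans (inward_bound S) _.
  by rewrite expnM; case: #|S| Sk => // s sk; rewrite leq_exp2r.
by nia.
Qed.

Lemma card_star x : #|boundary [set x]| = d.
Proof.
have := @isoperimetry [set x] 0; rewrite cards1 mul1n subn0 => /(_ isT) le.
apply/eqP; rewrite eqn_leq le andbT card_boundary.
apply: (@leq_trans #|setX [set x] [set: 'I_d]|); last first.
  by rewrite cardsX cards1 cardsT card_ord mul1n.
by apply: subset_leq_card; apply/subsetP => p; rewrite !inE => /andP[->].
Qed.

Lemma degree_le_steps : d <= nsteps d.
Proof.
rewrite -card_cube_edges -[leqLHS](card_star [ffun=> false]).
exact/subset_leq_card/boundary_sub.
Qed.

(** * Connected vertex sets as traces of walks *)

Definition walkset x (ds : seq 'I_d) := [set y in x :: scanl flip x ds].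

Lemma walkset_cons x i ds : walkset x (i :: ds) = x |: walkset (flip x i) ds.
Proof. by apply/setP => y; rewrite !inE. Qed.

Lemma walkset_start x ds : x \in walkset x ds.
Proof. by rewrite !inE eqxx. Qed.

(** A walk through [y] can step to any neighbour of [y] and back again. *)
Lemma walkset_detour x ds y : y \in walkset x ds -> forall i, exists2 ds',
  size ds' = (size ds).+2 & walkset x ds' = flip y i |: walkset x ds.
Proof.
elim: ds x => [|k ds IH] x.
  rewrite !inE => /eqP-> i; exists [:: i; i] => //.
  apply/setP => z; rewrite !inE flipK.
  by case: (z == x); rewrite ?orbT ?orbF.
rewrite walkset_cons => /setU1P[-> i|ys i].
  exists [:: i, i, k & ds] => //.
  rewrite !walkset_cons flipK; apply/setP => z; rewrite !inE.
  by case: (z == x); rewrite ?orbT.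
have [ds' sz ws] := IH _ ys i.
by exists (k :: ds'); rewrite /= ?sz // !walkset_cons ws setUCA.
Qed.

(** A connected set is explored by adding its vertices one at a time, each at
    the cost of a detour of length two. *)
Lemma walkset_spans S x : x \in S ->
  (forall T : {set vertex d}, T \proper S -> x \in T ->
     exists2 y, y \in T & exists i, flip y i \in S :\: T) ->
  exists2 ds, size ds = 2 * #|S|.-1 & walkset x ds = S.
Proof.
move=> xS grow.
have step k : k < #|S| -> exists ds,
    [/\ size ds = 2 * k, walkset x ds \subset S & #|walkset x ds| = k.+1].
  elim: k => [_|k IH kS].
    exists [::]; split=> //.
      by apply/subsetP => y; rewrite !inE => /eqP->.
    rewrite (_ : walkset x [::] = [set x]) ?cards1 //.
    by apply/setP => y; rewrite !inE.
  have [ds [sz sub card]] := IH (ltnW kS).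
  have pr : walkset x ds \proper S by rewrite properEcard sub card.
  have [y yT [i]] := grow _ pr (walkset_start _ _).
  rewrite inE => /andP[fT fS].
  have [ds' sz' ws'] := walkset_detour yT i; exists ds'; split.
  - by rewrite sz' sz; lia.
  - by rewrite ws' subUset sub1set fS.
  - by rewrite ws' cardsU1 fT card.
have S0 : 0 < #|S| by apply/card_gt0P; exists x.
have [|ds [sz sub card]] := step #|S|.-1; first by rewrite prednK.
by exists ds => //; apply/eqP; rewrite eqEcard sub card prednK /=.
Qed.
End Cube.

(** * Components, cuts and hitting times *)

Section Components.
Variables (d : nat) (G : graph d).
Hypothesis GE : G \subset cube_edges d.
Implicit Types (x y : vertex d) (S : {set vertex d}).

Lemma adj_sym : symmetric (adj G).
Proof. by move=> x y; rewrite /adj eq_sym setUC. Qed.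

Lemma adj_flip x y : adj G x y -> exists i, y = flip x i.
Proof. by case/andP => _ /(subsetP GE)/set2_flip. Qed.

Lemma edge_adj x i : adj G x (flip x i) = ([set x; flip x i] \in G).
Proof. by rewrite /adj eq_sym flip_neq. Qed.

Lemma closed_boundary S :
  closed (adj G) (mem S) <-> [disjoint boundary S & G].
Proof.
split=> [cl|dis].
  rewrite disjoint_subset; apply/subsetP => e /imsetP[[x i]].
  rewrite inE /= => /andP[xS fS] ->.
  by rewrite inE -edge_adj; apply: contra fS => /cl <-.
have half x y : adj G x y -> x \in S -> y \in S.
  move=> xy xS; have [i yi] := adj_flip xy.
  rewrite -[_ \in _]negbK; apply/negP => yS.
  have /(disjointFr dis) : [set x; y] \in boundary S.
    by apply/imsetP; exists (x, i); rewrite ?inE /= -?yi // xS.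
  by rewrite yi -edge_adj -yi xy.
by move=> x y xy; apply/idP/idP; apply: half; rewrite // adj_sym.
Qed.

Definition component x := [set y | connect (adj G) x y].

Lemma component_closed x : [disjoint boundary (component x) & G].
Proof.
apply/closed_boundary => y z yz; rewrite !inE.
by apply/idP/idP => /connect_trans; apply; apply: connect1; rewrite // adj_sym.
Qed.

Lemma component_walk x :
  exists2 ds, size ds = 2 * #|component x|.-1 & walkset x ds = component x.
Proof.
apply: walkset_spans => [|T /properP[TS [z zS zT]] xT].
  by rewrite inE connect0.
suff /existsP[y /andP[yT /existsP[i]]] :
    [exists y, (y \in T) && [exists i, flip y i \in component x :\: T]].
  by exists y => //; exists i.
apply: contraNT zT => /existsPn noexit.
have Tcl y t : adj G y t -> y \in T -> t \in T.
  move=> yt yT; have := noexit y; rewrite yT => /existsPn.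
  have [i ti] := adj_flip yt; move=> /(_ i).
  rewrite -ti !inE negb_and negbK => /orP[//|/negP[]].
  have := subsetP TS _ yT; rewrite inE => /connect_trans; apply.
  exact: connect1.
have cl : closed (adj G) (mem T).
  by move=> y t yt; apply/idP/idP; apply: Tcl; rewrite // adj_sym.
by move: zS; rewrite inE => /(closed_connect cl) => <-.
Qed.

(** A set that no edge leaves is determined by the component roots in it. *)
Lemma card_closed :
  #|[set D : {set vertex d} | [disjoint boundary D & G]]|
    <= 2 ^ #|[set x | fingraph.roots (adj G) x]|.
Proof.
rewrite -card_powerset.
pose f (D : {set vertex d}) := D :&: [set x | fingraph.roots (adj G) x].
have cs := sym_connect_sym adj_sym.
rewrite -(@card_in_imset _ _ f).
  apply: subset_leq_card; apply/subsetP => _ /imsetP[D _ ->].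
  by rewrite powersetE subsetIr.
move=> D D'; rewrite !inE => /closed_boundary cl /closed_boundary cl' ff'.
apply/setP => x.
have := congr1 (fun A : {set _} => fingraph.root (adj G) x \in A) ff'.
rewrite /f !in_setI !in_set roots_root // !andbT.
have xr := connect_root (adj G) x.
by rewrite -(closed_connect cl xr) -(closed_connect cl' xr).
Qed.

Definition isolated : {set vertex d} :=
  [set x | [disjoint boundary [set x] & G]].

Lemma component_isolated x : #|component x| <= 1 -> x \in isolated.
Proof.
move=> c1; rewrite inE (_ : [set x] = component x) ?component_closed //.
by apply/eqP; rewrite eqEcard cards1 c1 sub1set inE connect0.
Qed.

Lemma degree_isolated x : (0 < degree G x) = (x \notin isolated).
Proof.
rewrite inE; apply/card_gt0P/idP => [[y]|].
  rewrite inE => xy; apply/negP => /closed_boundary/(_ _ _ xy).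
  by rewrite !inE eqxx; case/andP: xy; rewrite eq_sym => /negbTE->.
rewrite -setI_eq0 => /set0Pn[e /setIP[/imsetP[[y i]]]].
rewrite !inE /= => /andP[/eqP-> _] -> eG; exists (flip x i).
by rewrite inE edge_adj.
Qed.

Lemma min_degree_isolated : (1 <= min_degree G) = (isolated == set0).
Proof.
rewrite leq_min_degree; apply/forallP/eqP => [H|H x].
  by apply/setP => x; rewrite in_set0; apply/negbTE; rewrite -degree_isolated.
by rewrite degree_isolated H inE.
Qed.

Lemma connected_isolated : 0 < d -> connected G -> isolated = set0.
Proof.
move=> d0 /forallP con; apply/setP => x; rewrite inE in_set0; apply/negP.
move/closed_boundary/closed_connect.
move/(_ _ _ (forallP (con x) (flip x (Ordinal d0)))).
by rewrite !inE eqxx (negbTE (flip_neq _ _)).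
Qed.
End Components.

Section Cuts.
Variable d : nat.
Implicit Types (G : graph d) (x : vertex d) (D : {set vertex d}).

Lemma boundary_disjointW D G G' :
  G' \subset G -> [disjoint boundary D & G] -> [disjoint boundary D & G'].
Proof.
by move=> sub; rewrite disjoint_sym => /(disjointWl sub); rewrite disjoint_sym.
Qed.

(** Connectedness is expressed by a covering walk, whose length is tied to
    the number of vertices, because walks are what the union bound counts. *)
Definition small_cut_size k G :=
  [exists p : vertex d * (2 * k.-1).-tuple 'I_d,
    (#|walkset p.1 p.2| == k) && [disjoint boundary (walkset p.1 p.2) & G]].

Definition small_cut s G :=
  [exists k : 'I_s.+1, (1 < k) && small_cut_size k G].

Definition large_cuts s G : {set {set vertex d}} :=
  [set D | [&& [disjoint boundary D & G], s <= #|D| & 2 * #|D| <= 2 ^ d]].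

(** Taking [G] smaller than [H] covers both the components of [G] itself and,
    through [H], those of the graph at a later time. *)
Lemma component_large s G (H : graph d) x : ~~ small_cut s G ->
  G \subset H -> H \subset cube_edges d ->
  1 < #|component H x| -> s < #|component H x|.
Proof.
move=> ns GH HE c1; rewrite ltnNge; apply: contra ns => cs.
have [ds /eqP sz ws] := component_walk HE x.
apply/existsP; exists (Ordinal (cs : #|component H x| < s.+1)); rewrite c1 /=.
apply/existsP; exists (x, Tuple sz); rewrite /= ws eqxx.
exact: boundary_disjointW GH (component_closed HE x).
Qed.

(** The non-trivial components are disjoint and have more than [2^j] vertices
    each, so there are at most [2^(d - j)] of them. *)
Lemma card_roots j G : G \subset cube_edges d -> j <= d ->
  ~~ small_cut (2 ^ j) G ->
  #|[set x | fingraph.roots (adj G) x]| <= #|isolated G| + 2 ^ (d - j).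
Proof.
move=> GE jd ns.
pose big := [set x | fingraph.roots (adj G) x & 1 < #|component G x|].
have cbig : #|big| * 2 ^ j <= 2 ^ d.
  have <- : #|{: vertex d}| = 2 ^ d by rewrite card_ffun card_bool card_ord.
  apply: (@leq_trans (\sum_(x in big) #|component G x|)).
    rewrite -sum_nat_const; apply: leq_sum => x; rewrite inE => /andP[_ c1].
    exact/ltnW/(component_large ns (subxx _) GE c1).
  rewrite -sum1_card.
  rewrite (eq_bigr (fun x => \sum_(y in component G x) 1)); last first.
    by move=> x _; rewrite sum1_card.
  rewrite (exchange_big_dep xpredT) //=; apply: leq_sum => y _.
  rewrite sum1dep_card; apply/card_le1_eqP => x x'; rewrite !inE.
  move=> /andP[/andP[/eqP rx _] xy] /andP[/andP[/eqP rx' _] x'y].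
  have cs := sym_connect_sym (@adj_sym _ G).
  suff /eqP : fingraph.root (adj G) x == fingraph.root (adj G) x'.
    by rewrite rx rx'.
  by rewrite root_connect // (connect_trans xy) // cs.
have -> : 2 ^ (d - j) = 2 ^ d %/ 2 ^ j by rewrite expnB.
apply: leq_trans (leq_add (leqnn _) (_ : #|big| <= _)); last first.
  by rewrite leq_divRL ?expn_gt0.
apply: leq_trans (leq_card_setU _ _); apply: subset_leq_card.
apply/subsetP => x; rewrite in_setU inE => rx.
case: (leqP #|component G x| 1) => [/(component_isolated GE)->//|c1].
by rewrite [x \in big]inE rx c1 orbT.
Qed.

(** Without such cuts every component fills more than half of the cube, so
    there is only one. *)
Lemma no_cut_connected s G1 G0 G : ~~ small_cut s G1 ->
  (forall D, D \in large_cuts s G1 -> ~~ [disjoint boundary D & G0]) ->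
  G1 \subset G0 -> G0 \subset G -> G \subset cube_edges d ->
  isolated G = set0 -> connected G.
Proof.
move=> ns nl G10 G0G GE iso0; apply/forallP => x; apply/forallP => y.
apply/negPn/negP => xy.
have big z : 2 ^ d < 2 * #|component G z|.
  rewrite ltnNge; apply/negP => half; have dis := component_closed GE z.
  have c1 : 1 < #|component G z|.
    by rewrite ltnNge; apply/negP => /(component_isolated GE); rewrite iso0 inE.
  have G1G := subset_trans G10 G0G.
  have sz := component_large ns G1G GE c1.
  have /nl/negP[] : component G z \in large_cuts s G1.
    by rewrite inE (boundary_disjointW G1G dis) (ltnW sz) half.
  exact: boundary_disjointW dis.
have := big x; have := big y.
have : #|component G x| + #|component G y| <= 2 ^ d.
  rewrite -cardsUI (_ : _ :&: _ = set0) ?cards0 ?addn0; last first.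
    apply/setP => z; rewrite !inE; apply/negP => /andP[xz yz].
    case/negP: xy; rewrite (connect_trans xz) //.
    by rewrite (sym_connect_sym (@adj_sym _ G)).
  by apply: leq_trans (max_card _) _; rewrite card_ffun card_bool card_ord.
by lia.
Qed.
End Cuts.

(** * The process as a uniform order on the edges *)

Lemma card_extensions (T : finType) (F : {set T}) n (s : seq T) :
  uniq s -> {subset s <= F} -> size s <= n ->
  #|[set w : n.-tuple T | [&& all (mem F) w, uniq w & take (size s) w == s]]|
    = (#|F| - size s) ^_ (n - size s).
Proof.
move=> us sF sn; set F' := [set e in F | e \notin s].
have cF' : #|F'| = #|F| - size s.
  rewrite -(cardsID [set e in s] F) (_ : F :&: _ = [set e in s]); last first.
    apply/setP => e; rewrite !inE.
    by case: (boolP (e \in s)) => [/sF->|]; rewrite ?andbF.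
  rewrite [#|[set e in s]|]cardsE (card_uniqP us) addKn.
  by apply: eq_card => e; rewrite !inE; exact: andbC.
rewrite -cF' -card_uniq_tuples.
pose f (w : n.-tuple T) := [tuple of drop (size s) w].
rewrite -(@card_in_imset _ _ f).
  apply: eq_card => t; rewrite !inE.
  apply/imsetP/andP => [[w]|[/allP tF ut]].
    rewrite inE => /and3P[/allP wF uw /eqP tw] ->.
    move: uw wF; rewrite -{1 2}(cat_take_drop (size s) w) tw cat_uniq.
    move=> /and3P[_ /hasPn ns ->] wF.
    split => //; apply/allP => e ed; apply/setIdP; split; last exact: ns.
    by apply: wF; rewrite mem_cat ed orbT.
  have sz : size (s ++ t) == n by rewrite size_cat size_tuple subnKC.
  exists (Tuple sz); last by apply: val_inj; rewrite /= drop_size_cat.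
  rewrite inE /= all_cat take_size_cat // cat_uniq us ut eqxx /= !andbT -!andbA.
  apply/and3P; split; first exact/allP.
    by apply/allP => e /tF /setIdP[].
  by apply/hasPn => e /tF /setIdP[].
move=> w w'; rewrite !inE => /and3P[_ _ /eqP tw] /and3P[_ _ /eqP tw'].
move=> /(congr1 val) /= dw; apply: val_inj.
by rewrite /= -(cat_take_drop (size s) w) tw dw -{1}tw' cat_take_drop.
Qed.

(** Divided by [M ^_ b], both sides count the orders of [M] items in which [b]
    given items avoid the first [r] places: either the places are filled one at a time, or the
    [b] items choose their places first.  The second form is the one that gives
    a [b]-th power. *)
Lemma ffact_swap M b r : b <= M -> r <= M ->
  (M - b) ^_ r * (M - r)`! * M ^_ b = M`! * (M - r) ^_ b.
Proof.
move=> bM rM; have [br|br] := leqP (b + r) M; last first.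
  by rewrite (@ffact_small (M - b) r) ?(@ffact_small (M - r) b) ?muln0 //; lia.
have := ffact_fact (_ : r <= M - b); have := ffact_fact (_ : b <= M - r).
have := ffact_fact bM.
move=> e1 /(_ ltac:(lia)) e2 /(_ ltac:(lia)) e3.
have e : M - b - r = M - r - b by lia.
apply/eqP; rewrite -(eqn_pmul2r (fact_gt0 (M - b - r))); apply/eqP.
rewrite -e1 {2}e -e2 -e3 -e; ring.
Qed.

Lemma ffact_ratio a b M : a <= M -> a ^_ b * M ^ b <= a ^ b * M ^_ b.
Proof.
move=> aM; elim: b => [|b IH]; first by rewrite !ffactn0.
rewrite !ffactnSr !expnSr.
have h : (a - b) * M <= a * (M - b).
  by rewrite mulnBl mulnBr leq_sub2l // (mulnC a) leq_mul2l aM orbT.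
rewrite (_ : _ * (M ^ b * M) = (a ^_ b * M ^ b) * ((a - b) * M)); last by ring.
rewrite (_ : _ * (M ^_ b * (M - b)) = (a ^ b * M ^_ b) * (a * (M - b))).
  exact: leq_mul.
by ring.
Qed.

Lemma ffact_shift a c k M :
  a <= M -> (a - c) ^_ k * M ^_ k <= a ^_ k * (M - c) ^_ k.
Proof.
move=> aM; elim: k => // k IH; rewrite !ffactnSr !mulnA.
rewrite (mulnAC _ (a - c - k)) (mulnAC _ (a - k)) -mulnA -[leqRHS]mulnA.
apply: leq_mul IH _; have [->//|ack] := posnP (a - c - k).
have -> : M - k = (M - c - k) + c by lia.
have -> : a - k = (a - c - k) + c by lia.
have : a - c - k <= M - c - k by lia.
nia.
Qed.

Lemma ffact_lower a k n : n <= k -> (a - k) ^ n <= a ^_ n.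
Proof.
elim: n => // n IH nk; rewrite ffactnSr expnSr; apply: leq_mul.
  exact/IH/ltnW.
lia.
Qed.

Lemma ffact_upper a n : a ^_ n <= a ^ n.
Proof. by elim: n => // n IH; rewrite ffactnSr expnSr leq_mul ?leq_subr. Qed.

Section Process.
Variables (R : realType) (d : nat).
Local Notation N := (nsteps d).
Local Notation E := (cube_edges d).
Implicit Types (w : trajectory d) (A B : pred (trajectory d)) (G : graph d).

Definition orders : {set trajectory d} :=
  [set w : trajectory d | all (mem E) w & uniq w].

Lemma card_Q w i : w \in orders -> i <= N -> #|Q w i| = i.
Proof.
rewrite inE => /andP[_ uw] iN.
by rewrite cardsE (card_uniqP _) ?take_uniq // size_takel // size_tuple.
Qed.

Lemma Q_sub w i : w \in orders -> Q w i \subset E.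
Proof.
rewrite inE => /andP[/allP wE _]; apply/subsetP => e; rewrite inE => /mem_take.
exact: wE.
Qed.

Lemma Q_mono w i j : i <= j -> Q w i \subset Q w j.
Proof.
move=> ij; apply/subsetP => e; rewrite !inE => ew.
by rewrite -(subnKC ij) takeD mem_cat ew.
Qed.

(** The two hitting times are defined by the same search, on predicates that
    agree at every time. *)
Lemma tau_eq s m1 m0 w : 0 < d -> w \in orders -> m1 <= m0 ->
  ~~ small_cut s (Q w m1) ->
  (forall D, D \in large_cuts s (Q w m1) ->
     ~~ [disjoint boundary D & Q w m0]) ->
  isolated (Q w m0) != set0 -> tau_D w == tau_C w.
Proof.
move=> d0 wo m10 ns nl /set0Pn[x xi].
have same t : (1 <= min_degree (Q w t)) = connected (Q w t).
  have QE := Q_sub t wo; rewrite min_degree_isolated //.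
  apply/eqP/idP; last exact: connected_isolated.
  move=> iso0; have [tm|/ltnW tm] := leqP t m0.
    suff : x \in isolated (Q w t) by rewrite iso0 inE.
    by move: xi; rewrite !inE; apply: boundary_disjointW; apply: Q_mono.
  by apply: (no_cut_connected ns nl) => //; apply: Q_mono.
by apply/eqP; apply: eq_find => t; rewrite !same.
Qed.

Local Open Scope ring_scope.

Lemma process_lawE w : process_law R w = (w \in orders)%:R / N`!%:R.
Proof.
rewrite /process_law; case: (boolP (w \in orders)) => wo; last first.
  have [i bad] : exists i : 'I_N, tnth w i \notin E :\: Q w i.
    apply/existsP; apply: contraNT wo => /existsPn good.
    have {}good i : tnth w i \in E :\: Q w i by rewrite -[_ \in _]negbK good.
    rewrite inE; apply/andP; split.
      by apply/allP => e /tnthP[i ->]; have := good i; rewrite inE => /andP[].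
    apply/(uniqPn set0) => -[i [j [ij]]]; rewrite size_tuple => jm eij.
    have := good (Ordinal jm).
    rewrite !inE (tnth_nth set0) /= -eij => /andP[/negP[]].
    rewrite in_take_leq ?size_tuple ?(ltnW jm) //.
    apply: (leq_ltn_trans _ ij).
    by rewrite index_nth // size_tuple (ltn_trans ij).
  by rewrite mul0r (bigD1 i) //= /step_law (negbTE bad) mul0r.
have := wo; rewrite inE => /andP[/allP wE uw].
under eq_bigr => i _.
  rewrite /step_law cardsD (setIidPr (Q_sub i wo)) card_Q //; last exact: ltnW.
  rewrite card_cube_edges ifT; last first.
    rewrite inE [tnth w i \in E]wE ?mem_tnth // andbT inE (tnth_nth set0).
    rewrite in_take_leq ?size_tuple ?(ltnW (ltn_ord i)) //.
    by rewrite index_uniq ?size_tuple // ltnn.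
  over.
rewrite mul1r prodfV -natr_prod fact_prod; congr (_ %:R^-1)%R.
rewrite (reindex_inj rev_ord_inj) /= big_add1 /= big_mkord.
by apply: eq_bigr => i _; rewrite subnA ?subnn ?add0n.
Qed.

Lemma process_law_ge0 w : 0 <= process_law R w.
Proof. by rewrite process_lawE divr_ge0. Qed.

Lemma Pr_ge0 A : 0 <= Pr R A.
Proof. by apply: sumr_ge0 => w _; exact: process_law_ge0. Qed.

Lemma PrE A : Pr R A = #|[set w in orders | A w]|%:R / N`!%:R.
Proof.
rewrite /Pr (eq_bigr _ (fun w _ => process_lawE w)) -mulr_suml -natr_sum.
congr (_%:R / _); rewrite -sum1_card big_mkcond [RHS]big_mkcond.
by apply: eq_bigr => w _; rewrite !inE; case: (A w); rewrite ?andbT ?andbF.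
Qed.

Lemma Pr_le A B : (forall w, w \in orders -> A w -> B w) -> Pr R A <= Pr R B.
Proof.
move=> AB; rewrite !PrE ler_wpM2r ?invr_ge0 // ler_nat; apply: subset_leq_card.
by apply/subsetP => w; rewrite !inE => /andP[wo Aw]; rewrite wo AB ?inE.
Qed.

Lemma Pr_compl A : Pr R A = 1 - Pr R (fun w => ~~ A w).
Proof. by rewrite -(Pr_total R d) /Pr [X in _ = X - _](bigID A) /= addrK. Qed.

Lemma PrU A B : Pr R (fun w => A w || B w) <= Pr R A + Pr R B.
Proof.
rewrite /Pr ![X in _ + X]big_mkcond [X in X <= _]big_mkcond.
rewrite [X in X + _]big_mkcond /= -big_split /=.
apply: ler_sum => w _; have := process_law_ge0 w.
by case: (A w); case: (B w) => /=; lra.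
Qed.

Lemma union_bound (I : finType) (P : pred I) (A : I -> pred (trajectory d)) n
    (c : R) :
  (#|P| <= n)%N -> 0 <= c -> (forall i, P i -> Pr R (A i) <= c) ->
  Pr R (fun w => [exists i, P i && A i w]) <= n%:R * c.
Proof.
move=> Pn c0 Ac; apply: (@le_trans _ _ (\sum_(i | P i) Pr R (A i))); last first.
  apply: (@le_trans _ _ (\sum_(i in P) c)); first exact: ler_sum.
  by rewrite sumr_const -[leLHS]mulr_natl ler_wpM2r // ler_nat.
rewrite /Pr [X in X <= _]big_mkcond /=.
rewrite (eq_bigr _ (fun i _ => big_mkcond _ _)) /= exchange_big /=.
apply: ler_sum => w _; have ge0 i : 0 <= if A i w then process_law R w else 0.
  by case: ifP => // _; exact: process_law_ge0.
case: ifP => [/existsP[i /andP[Pi Ai]]|_]; last exact: sumr_ge0.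
by rewrite (bigD1 i) //= Ai lerDl sumr_ge0.
Qed.

Lemma Pr_markov (I : finType) (S : trajectory d -> {set I}) (p : R) (T : nat) :
  (forall i, Pr R (fun w => i \in S w) <= p) ->
  T%:R * Pr R (fun w => T <= #|S w|)%N <= #|I|%:R * p.
Proof.
move=> Sp; apply: (@le_trans _ _ (\sum_i Pr R (fun w => i \in S w))); last first.
  by rewrite mulrC mulr_natr -sumr_const; exact: ler_sum.
rewrite /Pr [leRHS](eq_bigr _ (fun i _ => big_mkcond _ _)) /= exchange_big /=.
rewrite mulr_sumr big_mkcond /=.
apply: ler_sum => w _; rewrite -big_mkcond sumr_const.
have lw := process_law_ge0 w.
case: ifP => [TS|_]; last by rewrite mulrn_wge0.
by rewrite mulr_natl ler_wpMn2l.
Qed.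

(** Chebyshev's inequality at 0 for the number of events that occur: pairwise
    non-positive correlation makes its variance at most its mean. *)
Lemma Pr_second_moment (I : finType) (A : {set I})
    (Y : I -> pred (trajectory d)) (p : R) :
  0 < p -> (0 < #|A|)%N ->
  (forall i, i \in A -> Pr R (Y i) = p) ->
  (forall i j, i \in A -> j \in A -> i != j ->
     Pr R (fun w => Y i w && Y j w) <= p ^+ 2) ->
  #|A|%:R * p * Pr R (fun w => [forall (i | i \in A), ~~ Y i w]) <= 1.
Proof.
move=> p0 A0 Y1 Y2; set mu := _ * p; set Z := Pr R _.
have mu0 : 0 < mu by rewrite mulr_gt0 ?ltr0n.
pose X w : R := \sum_(i in A) (Y i w)%:R.
have Pr1 (B : pred (trajectory d)) :
    Pr R B = \sum_w process_law R w * (B w)%:R.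
  rewrite /Pr big_mkcond; apply: eq_bigr => w _.
  by case: (B w); rewrite ?mulr1 ?mulr0.
have EX : \sum_w process_law R w * X w = mu.
  under eq_bigr do rewrite mulr_sumr.
  rewrite exchange_big /= /mu mulr_natl -sumr_const; apply: eq_bigr => i iA.
  by rewrite -Pr1 Y1.
have EX2 : \sum_w process_law R w * X w ^+ 2 <= mu + mu ^+ 2.
  have -> : \sum_w process_law R w * X w ^+ 2 =
      \sum_(i in A) \sum_(j in A) Pr R (fun w => Y i w && Y j w).
    under [RHS]eq_bigr => i _ do (under eq_bigr => j _ do rewrite Pr1);
    under [RHS]eq_bigr => i _ do rewrite exchange_big.
    rewrite [RHS]exchange_big; apply: eq_bigr => w _ /=.
    rewrite expr2 /X mulr_suml mulr_sumr; apply: eq_bigr => i _.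
    rewrite !mulr_sumr; apply: eq_bigr => j _.
    by rewrite -mulnb natrM.
  have -> : mu + mu ^+ 2 = \sum_(i in A) (p + #|A|%:R * p ^+ 2).
    rewrite sumr_const -mulr_natl /mu; ring.
  apply: ler_sum => i iA; rewrite (bigD1 i) //=; apply: lerD.
    by rewrite -(Y1 i iA) /Pr; under eq_bigl do rewrite andbb.
  rewrite mulr_natl -sumr_const [leRHS](bigD1 i) //= -[leLHS]add0r.
  apply: lerD; first by rewrite exprn_ge0 // ltW.
  by apply: ler_sum => j /andP[jA ji]; apply: Y2 => //; rewrite eq_sym.
have E1 : \sum_(w : trajectory d) process_law R w = 1 by exact: (Pr_total R d).
have : mu ^+ 2 * Z <= \sum_w process_law R w * (X w - mu) ^+ 2.
  rewrite /Z (Pr1 (fun w => [forall (i | i \in A), ~~ Y i w])) mulr_sumr.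
  apply: ler_sum => w _.
  rewrite mulrCA; apply: ler_wpM2l; first exact: process_law_ge0.
  have [/forallP H|_] := boolP [forall (i | i \in A), ~~ Y i w]; last first.
    by rewrite mulr0 sqr_ge0.
  rewrite mulr1 /X big1 ?sub0r ?sqrrN // => i iA.
  by have /implyP/(_ iA)/negbTE-> := H i.
have -> : \sum_w process_law R w * (X w - mu) ^+ 2
    = \sum_w process_law R w * X w ^+ 2 - mu ^+ 2.
  transitivity (\sum_w process_law R w * X w ^+ 2
    - 2 * mu * (\sum_w process_law R w * X w)
    + mu ^+ 2 * (\sum_(w : trajectory d) process_law R w)).
    rewrite !mulr_sumr -sumrB -big_split /=; apply: eq_bigr => w _; ring.
  by rewrite EX E1; ring.
move=> H; have H2 : mu * (mu * Z) <= mu * 1.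
  by rewrite mulr1 mulrA -expr2; apply: le_trans H _; rewrite lerBlDr.
by rewrite ler_pM2l in H2.
Qed.

(** * Avoiding a set of edges *)

Lemma card_prefix m (s : seq {set vertex d}) :
  uniq s -> {subset s <= E} -> size s = m -> (m <= N)%N ->
  #|[set w in orders | take m w == s]| = (N - m)`!.
Proof.
move=> us sE <- sN; have := card_extensions us sE sN.
rewrite card_cube_edges ffactnn => <-.
by apply: eq_card => w; rewrite !inE andbA.
Qed.

Lemma card_prefix_avoid m1 m0 (s : seq {set vertex d}) (B : graph d) :
  uniq s -> {subset s <= E} -> size s = m1 -> (m1 <= m0 <= N)%N ->
  B \subset E -> [disjoint B & [set e in s]] ->
  #|[set w in orders | (take m1 w == s) && [disjoint B & Q w m0]]| =
  ((N - m1 - #|B|) ^_ (m0 - m1) * (N - m0)`!)%N.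
Proof.
move=> us sE sm1 /andP[m10 m0N] BE Bs; set D := [set w in _ | _].
pose f w : m0.-tuple {set vertex d} :=
  tcast (minn_idPl m0N) [tuple of take m0 w].
have fE w : f w = take m0 w :> seq _ by rewrite val_tcast.
have sEB : {subset s <= E :\: B}.
  by move=> e es; rewrite inE sE // andbT (disjointFl Bs) // inE.
set U := [set u : m0.-tuple {set vertex d} |
  [&& all (mem (E :\: B)) u, uniq u & take (size s) u == s]].
have cU : #|U| = (N - m1 - #|B|) ^_ (m0 - m1).
  by rewrite card_extensions ?sm1 // cardsD (setIidPr BE) card_cube_edges subnAC.
(* the trajectories are grouped according to their first m0 edges *)
rewrite -sum1_card (partition_big f (mem U)) /=; last first.
  move=> w; rewrite !inE fE => /andP[/andP[/allP wE uw] /andP[/eqP tw dis]].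
  rewrite take_uniq // andTb take_takel ?sm1 // tw eqxx andbT.
  apply/allP => e et; apply/setDP; split; first by apply/wE/(mem_take et).
  by apply/negP => eB; have := disjointFr dis eB; rewrite inE et.
rewrite -cU -sum_nat_const; apply: eq_bigr => u.
rewrite inE => /and3P[/allP uEB uu /eqP tu].
rewrite sum1dep_card -(@card_prefix m0 u) ?size_tuple //; last first.
  by move=> e /uEB /setDP[].
apply: eq_card => w; rewrite !inE -(inj_eq val_inj) /= fE.
case: (take m0 w =P u) => [twu|]; rewrite ?andbF // !andbT.
rewrite -(take_takel _ m10) twu -sm1 tu eqxx /=.
suff -> : [disjoint B & Q w m0] by rewrite andbT.
rewrite disjoint_sym disjoint_subset; apply/subsetP => e; rewrite inE twu.
by move=> /uEB /setDP[].
Qed.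

Lemma Pr_prefix_avoid m1 m0 (s : seq {set vertex d}) (B : graph d) :
  uniq s -> {subset s <= E} -> size s = m1 -> (m1 <= m0 <= N)%N ->
  B \subset E -> [disjoint B & [set e in s]] ->
  Pr R (fun w => (take m1 w == s) && [disjoint B & Q w m0]) =
  Pr R (fun w => take m1 w == s)
    * (((N - m0) ^_ #|B|)%:R / ((N - m1) ^_ #|B|)%:R).
Proof.
move=> us sE sm1 /andP[m10 m0N] BE Bs; rewrite !PrE.
rewrite card_prefix_avoid ?m10 // card_prefix // ?(leq_trans m10) //.
have bM : (#|B| <= N - m1)%N.
  rewrite -card_cube_edges -sm1 -(card_uniqP us) -[#|s|]cardsE.
  have sub : [set e in s] \subset E by apply/subsetP => e; rewrite inE => /sE.
  rewrite -(setIidPr sub) -cardsD; apply: subset_leq_card.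
  by rewrite subsetD BE.
have := @ffact_swap (N - m1) #|B| (m0 - m1) bM (leq_sub2r _ m0N).
rewrite (_ : (N - m1 - (m0 - m1) = N - m0)%N); last by lia.
move=> e; rewrite mulrAC mulrA; congr (_ / _).
have nz : ((N - m1) ^_ #|B|)%:R != 0 :> R.
  by rewrite pnatr_eq0 -lt0n ffact_gt0.
by apply: (mulIf nz); rewrite mulfVK // -!natrM e.
Qed.

Lemma Pr_avoid m (B : graph d) : (m <= N)%N -> B \subset E ->
  Pr R (fun w => [disjoint B & Q w m])
    = ((N - m) ^_ #|B|)%:R / (N ^_ #|B|)%:R.
Proof.
move=> mN BE; have dis0 : [disjoint B & [set e in [::]]].
  by rewrite disjoint_sym disjoint_subset; apply/subsetP => e; rewrite inE.
have := @Pr_prefix_avoid 0 m [::] B isT _ erefl mN BE dis0; rewrite subn0.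
have eqP0 A : Pr R (fun w => (take 0 w == [::]) && A w) = Pr R A.
  by apply: eq_bigl => w; rewrite take0.
have -> : Pr R (fun w => take 0 w == [::]) = 1.
  by rewrite -(Pr_total R d); apply: eq_bigl => w; rewrite take0.
by rewrite eqP0 mul1r; apply.
Qed.

Lemma ffact_ratio_le a b k M :
  (a <= M)%N -> (0 < M)%N -> (b <= M)%N -> (k <= b)%N ->
  (a ^_ b)%:R / (M ^_ b)%:R <= (a%:R / M%:R) ^+ k :> R.
Proof.
move=> aM M0 bM kb; have M0' : 0 < M%:R :> R by rewrite ltr0n.
apply: (@le_trans _ _ ((a%:R / M%:R) ^+ b)); last first.
  apply: ler_wiXn2l => //; first by rewrite divr_ge0.
  by rewrite ler_pdivrMr // mul1r ler_nat.
rewrite expr_div_n ler_pdivrMr ?ltr0n ?ffact_gt0 //.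
rewrite mulrAC ler_pdivlMr ?exprn_gt0 //.
by rewrite -!natrX -!natrM ler_nat ffact_ratio.
Qed.

(** Conditionally on [Q m1], the edges of steps [m1 + 1] to [m0] are a uniform
    sample of the absent ones, so the union bound runs over a family of cuts
    that may depend on [Q m1]. *)
Lemma Pr_sprinkle (good : pred (graph d)) (F : graph d -> {set {set vertex d}})
    K b m1 m0 :
  (m1 <= m0 <= N)%N -> (m1 < N)%N ->
  (forall G, G \subset E -> good G -> (#|F G| <= K)%N) ->
  (forall G D, D \in F G -> [disjoint boundary D & G]) ->
  (forall G D, D \in F G -> (b <= #|boundary D|)%N) ->
  Pr R (fun w => good (Q w m1) &&
     [exists D, (D \in F (Q w m1)) && [disjoint boundary D & Q w m0]])
  <= K%:R * ((N - m0)%:R / (N - m1)%:R) ^+ b.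
Proof.
move=> m10N m1N FK Fdis Fb; have /andP[m10 m0N] := m10N; set rho := _ / _.
set ev := fun w => _.
have rho0 : 0 <= rho ^+ b by rewrite exprn_ge0 // divr_ge0.
have part (A : pred (trajectory d)) : Pr R A
    = \sum_(s : m1.-tuple {set vertex d}) Pr R (fun w => (take m1 w == s) && A w).
  pose f w : m1.-tuple {set vertex d} :=
    tcast (minn_idPl (ltnW m1N)) [tuple of take m1 w].
  rewrite /Pr (partition_big f xpredT) //=; apply: eq_bigr => s _.
  by apply: eq_bigl => w; rewrite andbC -(inj_eq val_inj) /= val_tcast.
have tot : \sum_(s : m1.-tuple {set vertex d})
    Pr R (fun w => take m1 w == s) = 1.
  rewrite -(Pr_total R d) [RHS]part; apply: eq_bigr => s _.
  by apply: eq_bigl => w; rewrite andbT.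
rewrite part -[leRHS]mulr1 -[X in _ <= _ * X]tot mulr_sumr.
apply: ler_sum => s _.
have p0 := Pr_ge0 (fun w => take m1 w == s).
pose Gs : graph d := [set e in s].
have [/and3P[us /subsetP sE gs]|bad] :=
    boolP [&& uniq s, Gs \subset E & good Gs]; last first.
  apply: (@le_trans _ _ 0); last by rewrite !mulr_ge0.
  rewrite (_ : 0 = Pr R (fun _ : trajectory d => false)); last first.
    by rewrite /Pr big_pred0.
  apply: (@Pr_le _ (fun=> false)) => w wo /andP[/eqP tw /andP[gw _]].
  case/negP: bad; have QG : Q w m1 = Gs by apply/setP => e; rewrite !inE tw.
  rewrite -tw take_uniq; last by move: wo; rewrite inE => /andP[].
  by rewrite -QG gw Q_sub.
apply: (@le_trans _ _ (Pr R (fun w => [exists D, (D \in F Gs) &&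
   ((take m1 w == s) && [disjoint boundary D & Q w m0])]))).
  apply: Pr_le => w wo /andP[/eqP tw /andP[_ /existsP[D /andP[DF dis]]]].
  apply/existsP; exists D; rewrite tw eqxx dis !andbT.
  by rewrite (_ : Gs = Q w m1) //; apply/setP => e; rewrite !inE tw.
rewrite -mulrA; apply: union_bound.
- by apply: FK gs; apply/subsetP.
- exact: mulr_ge0.
move=> D DF.
rewrite Pr_prefix_avoid ?size_tuple ?boundary_sub ?Fdis //; last first.
  by move=> e es; apply: sE; rewrite inE.
rewrite mulrC ler_wpM2r //; apply: ffact_ratio_le.
- exact: leq_sub2l.
- by rewrite subn_gt0.
- rewrite -card_cube_edges; have -> : m1 = #|Gs|.
    by rewrite cardsE (card_uniqP us) size_tuple.
  have GE : Gs \subset E by apply/subsetP.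
  by rewrite -{1}(setIidPr GE) -cardsD subset_leq_card // subsetD boundary_sub Fdis.
- exact: Fb DF.
Qed.

Lemma Pr_small_cut_size k i m : (m <= N)%N -> (0 < N)%N -> (k <= 2 ^ i)%N ->
  Pr R (fun w => small_cut_size k (Q w m))
  <= (2 ^ d * d ^ (2 * k.-1))%:R * ((N - m)%:R / N%:R) ^+ (k * (d - i)).
Proof.
move=> mN N0 ki; apply: union_bound.
- apply: leq_trans (max_card _) _.
  by rewrite card_prod card_tuple card_ffun card_bool !card_ord.
- by rewrite exprn_ge0 // divr_ge0.
move=> p /eqP ck; rewrite Pr_avoid ?boundary_sub //.
apply: ffact_ratio_le; rewrite ?leq_subr //.
  by rewrite -card_cube_edges subset_leq_card ?boundary_sub.
by have := @isoperimetry _ (walkset p.1 p.2) i; rewrite ck; apply.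
Qed.

(** * Isolated vertices *)

Lemma Pr_isolated m x : (m <= N)%N ->
  Pr R (fun w => x \in isolated (Q w m)) = ((N - m) ^_ d)%:R / (N ^_ d)%:R.
Proof.
move=> mN; have := Pr_avoid mN (boundary_sub [set x]); rewrite card_star => <-.
by apply: eq_bigl => w; rewrite inE.
Qed.

Lemma Pr_many_isolated m T : (0 < d)%N -> (m <= N)%N ->
  T%:R * Pr R (fun w => T <= #|isolated (Q w m)|)%N
    <= 2 ^+ d * ((N - m)%:R / N%:R) ^+ d.
Proof.
move=> d0 mN; rewrite -natrX.
have -> : (2 ^ d = #|{: vertex d}|)%N by rewrite card_ffun card_bool card_ord.
apply: Pr_markov => x; rewrite Pr_isolated //; have dN := degree_le_steps d.
by apply: ffact_ratio_le; rewrite ?leq_subr // (leq_trans d0).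
Qed.
End Process.

Section Parity.
Variable d : nat.

Definition parity (x : vertex d) := \big[addb/false]_i x i.
Definition even_vertices : {set vertex d} := [set x | ~~ parity x].

Lemma parity_flip x i : parity (flip x i) = ~~ parity x.
Proof.
rewrite /parity (bigD1 i) //= [in RHS](bigD1 i) //= ffunE eqxx addTb addNb.
by congr (~~ (_ (+) _)); apply: eq_bigr => k /negbTE ki; rewrite ffunE ki.
Qed.

Lemma card_even_vertices : 0 < d -> 2 ^ d <= 2 * #|even_vertices|.
Proof.
move=> d0; pose i := Ordinal d0.
have -> : 2 ^ d = #|{: vertex d}| by rewrite card_ffun card_bool card_ord.
rewrite -(cardsC even_vertices) mul2n -addnn leq_add2l.
rewrite -(card_imset _ (can_inj (flipK i))); apply: subset_leq_card.
apply/subsetP => _ /imsetP[x xe ->].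
by move: xe; rewrite !inE negbK parity_flip => ->.
Qed.

Lemma even_stars_disjoint x y :
  x \in even_vertices -> y \in even_vertices -> x != y ->
  [disjoint boundary [set x] & boundary [set y]].
Proof.
rewrite !inE => ex ey xy; rewrite disjoint_subset; apply/subsetP => e.
case/imsetP => -[x' i]; rewrite inE /= => /andP[/set1P-> _] ->.
apply/negP => /imsetP[[y' k]]; rewrite inE /= => /andP[/set1P-> _] ee.
have : x \in [set y; flip y k] by rewrite -ee set21.
by case/set2P => xE; move: xy ex; rewrite xE ?eqxx // parity_flip ey.
Qed.
End Parity.

Section NoIsolated.
Variables (R : realType) (d : nat).
Local Notation N := (nsteps d).
Local Open Scope ring_scope.

(** Vertices of even parity have disjoint stars, so each being isolated makes
    any other less likely to be: two stars take [2d] of the absent edges. *)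
Lemma Pr_no_isolated m (c : R) : (0 < d)%N -> (m <= N)%N -> 0 < c ->
  c * N%:R <= (N - m - d)%:R ->
  Pr R (fun w : trajectory d => isolated (Q w m) == set0)
    <= 2 / (2 * c) ^+ d.
Proof.
move=> d0 mN c0 cN.
set p := ((N - m) ^_ d)%:R / (N ^_ d)%:R : R.
have pc : c ^+ d <= p.
  have Nd : 0 < (N ^_ d)%:R :> R by rewrite ltr0n ffact_gt0 degree_le_steps.
  rewrite /p ler_pdivlMr //; apply: (@le_trans _ _ ((c * N%:R) ^+ d)).
    rewrite exprMn; apply: ler_wpM2l; first by rewrite exprn_ge0 ?ltW.
    by rewrite -natrX ler_nat ffact_upper.
  apply: (@le_trans _ _ ((N - m - d)%:R ^+ d)); last first.
    by rewrite -natrX ler_nat ffact_lower.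
  by apply: lerXn2r => //; rewrite nnegrE // mulr_ge0 // ltW.
have p0 : 0 < p by apply: lt_le_trans pc; rewrite exprn_gt0.
have cA := card_even_vertices d0.
have A0 : (0 < #|even_vertices d|)%N.
  by rewrite -(@ltn_pmul2l 2) // muln0; apply: leq_trans cA; rewrite expn_gt0.
have : #|even_vertices d|%:R * p * Pr R (fun w : trajectory d =>
    [forall (x | x \in even_vertices d), x \notin isolated (Q w m)]) <= 1.
  apply: (@Pr_second_moment R d _ _ (fun x w => x \in isolated (Q w m))) => //.
    by move=> x _; exact: Pr_isolated.
  move=> x y xe ye xy.
  have -> : Pr R (fun w : trajectory d =>
        (x \in isolated (Q w m)) && (y \in isolated (Q w m)))
      = Pr R (fun w =>
          [disjoint boundary [set x] :|: boundary [set y] & Q w m]).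
    by apply: eq_bigl => w; rewrite !inE -!setI_eq0 setIUl setU_eq0.
  have dis := even_stars_disjoint xe ye xy.
  have cU : #|boundary [set x] :|: boundary [set y]| = (d + d)%N.
    have := cardsUI (boundary [set x]) (boundary [set y]).
    by rewrite !card_star (disjoint_setI0 dis) cards0 addn0.
  rewrite Pr_avoid ?subUset ?boundary_sub // cU.
  have [Z|pos] := posnP (N ^_ (d + d)).
    by rewrite Z invr0 mulr0 sqr_ge0.
  have Nd : (0 < N ^_ d)%N by rewrite ffact_gt0 degree_le_steps.
  rewrite ler_pdivrMr ?ltr0n // /p expr_div_n mulrAC.
  rewrite ler_pdivlMr ?exprn_gt0 ?ltr0n // -!natrX -!natrM ler_nat.
  have ffD a : (a ^_ (d + d) = a ^_ d * (a - d) ^_ d)%N.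
    rewrite !ffact_prod big_split_ord /=; congr (_ * _)%N.
    by apply: eq_bigr => i _; rewrite subnDA.
  rewrite !ffD; have le := @ffact_shift (N - m) d d N (leq_subr _ _).
  have := leq_mul (leqnn ((N - m) ^_ d * N ^_ d)%N) le.
  by congr (_ <= _)%N; ring.
move=> H; set Z := Pr R _.
have ZE : Z <= Pr R (fun w : trajectory d =>
    [forall (i | i \in even_vertices d), i \notin isolated (Q w m)]).
  apply: Pr_le => w _ /eqP->; apply/forallP => x.
  by apply/implyP => _; rewrite inE.
have Z0 : 0 <= Z := Pr_ge0 _ _.
rewrite ler_pdivlMr ?exprn_gt0 ?mulr_gt0 // exprMn.
have cA' : 2 ^+ d <= 2 * #|even_vertices d|%:R :> R.
  by rewrite -natrX -natrM ler_nat.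
have H' : #|even_vertices d|%:R * p * Z <= 1.
  by apply: le_trans H; rewrite ler_wpM2l // mulr_ge0 // ltW.
apply: (@le_trans _ _ (Z * (2 * #|even_vertices d|%:R * p))); last by nra.
rewrite ler_wpM2l //; apply: ler_pM => //; first by rewrite exprn_ge0.
by rewrite exprn_ge0 // ltW.
Qed.
End NoIsolated.

(** * An explicit bound on the failure probability *)

Section Failure.
Variables (R : realType) (d q L : nat).
Hypotheses (d0 : 0 < d) (qd : q <= d).
(* N is a multiple of 16, so that 3N/8 and 7N/16 are integers *)
Hypotheses (NL : nsteps d = 16 * L) (dL : 2 * d <= L).
Local Notation N := (nsteps d).
Local Notation E := (cube_edges d).
Local Notation m1 := (6 * L).
Local Notation m0 := (7 * L).
Local Notation j := (d - q).
Local Open Scope ring_scope.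

Let L_neq0 : L%:R != 0 :> R. Proof. by rewrite pnatr_eq0; lia. Qed.

Lemma absent_m1 : (N - m1)%:R / N%:R = 5 / 8 :> R.
Proof.
have -> : (N - m1 = 10 * L)%N by lia.
rewrite NL !natrM; field; exact: L_neq0.
Qed.

Lemma absent_m0 : (N - m0)%:R / (N - m1)%:R = 9 / 10 :> R.
Proof.
have -> : (N - m1 = 10 * L)%N by lia.
have -> : (N - m0 = 9 * L)%N by lia.
rewrite !natrM; field; exact: L_neq0.
Qed.

(** The cost of one more vertex in a connected set: two steps of the covering
    walk, against [i] more boundary edges to avoid. *)
Definition cut_weight i : R := (d ^ 2)%:R * (5 / 8) ^+ i.

Lemma cut_weight_ge0 i : 0 <= cut_weight i.
Proof. by rewrite mulr_ge0 // exprn_ge0 // divr_ge0. Qed.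

Lemma Pr_small_cut_size_weight k i : (0 < k)%N -> (k <= 2 ^ i)%N ->
  Pr R (fun w : trajectory d => small_cut_size k (Q w m1))
    <= 2 ^+ d * cut_weight (d - i) ^+ k.
Proof.
move=> k0 ki; apply: le_trans (Pr_small_cut_size _ _ _ ki) _; [lia|lia|].
rewrite absent_m1 natrM natrX -mulrA [(_ * _ ^+ (d - i)) ^+ k]exprMn.
apply: ler_wpM2l; first by rewrite exprn_ge0.
rewrite [(k * _)%N]mulnC [in leLHS]exprM; apply: ler_wpM2r.
  by rewrite !exprn_ge0 ?divr_ge0.
by rewrite -natrX ler_nat -expnM; apply: leq_pexp2l => //; lia.
Qed.

(** For [k <= 16 = 2^4] the boundary is almost [kd], and already the second
    power of the weight beats the [2^d] starting vertices.  For [k > 16] only a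
    third of the boundary is guaranteed, but the sixteenth power of the weight
    beats the number [2^d] of vertices and that of the sizes [k]. *)
Lemma Pr_small_cut : cut_weight (d - 4) <= 1 -> cut_weight q <= 1 ->
  Pr R (fun w : trajectory d => small_cut (2 ^ j) (Q w m1))
    <= 17 * (2 ^+ d * cut_weight (d - 4) ^+ 2)
       + 2 * 2 ^+ d * (2 ^+ d * cut_weight q ^+ 16).
Proof.
move=> w1 w2; pose small k (w : trajectory d) := small_cut_size k (Q w m1).
apply: (@le_trans _ _ (Pr R (fun w =>
    [exists k : 'I_17, (1 < k)%N && small k w]
    || [exists k : 'I_(2 ^ j).+1, (16 < k)%N && small k w]))).
  apply: Pr_le => w _ /existsP[k /andP[k1 kw]].
  have [k16|k16] := leqP k 16; last first.
    by apply/orP; right; apply/existsP; exists k; rewrite k16.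
  apply/orP; left; apply/existsP; have k17 : (k < 17)%N by [].
  by exists (Ordinal k17); rewrite /= k1.
have pow2_ge0 : 0 <= 2 ^+ d :> R by rewrite exprn_ge0.
apply: le_trans (PrU _ _ _) _; apply: lerD.
  apply: union_bound.
  - by apply: leq_trans (max_card _) _; rewrite card_ord.
  - by rewrite mulr_ge0 // exprn_ge0 // cut_weight_ge0.
  - move=> k k1; apply: le_trans (@Pr_small_cut_size_weight k 4 _ _) _.
    + exact: ltnW.
    + by have := ltn_ord k.
    + by rewrite ler_wpM2l // ler_wiXn2l // cut_weight_ge0.
have weight_ge0 : 0 <= 2 ^+ d * cut_weight q ^+ 16.
  by rewrite mulr_ge0 // exprn_ge0 // cut_weight_ge0.
rewrite -natrX -natrM; apply: union_bound.
- apply: leq_trans (max_card _) _; rewrite card_ord mul2n -addnn -addn1.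
  by apply: leq_add; rewrite ?expn_gt0 // leq_exp2l // leq_subr.
- by rewrite natrX.
move=> k k1; apply: le_trans (@Pr_small_cut_size_weight k j _ _) _.
- by lia.
- by have := ltn_ord k.
- rewrite subKn // natrX ler_wpM2l // ler_wiXn2l ?cut_weight_ge0 //.
  exact: ltnW.
Qed.

Lemma Pr_isolated_m1 :
  Pr R (fun w : trajectory d => 2 ^ q <= #|isolated (Q w m1)|)%N
    <= (5 / 4) ^+ d / 2 ^+ q.
Proof.
rewrite ler_pdivlMr ?exprn_gt0 // mulrC -natrX.
apply: le_trans (Pr_many_isolated _ _ d0 _) _; first by lia.
rewrite absent_m1 -exprMn le_eqVlt; apply/orP; left; apply/eqP.
by congr (_ ^+ _); field.
Qed.

Let good (G : graph d) :=
  ~~ small_cut (2 ^ j) G && (#|isolated G| < 2 ^ q)%N.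

Lemma Pr_large_cut :
  Pr R (fun w : trajectory d => good (Q w m1) &&
      [exists D, (D \in large_cuts (2 ^ j) (Q w m1))
        && [disjoint boundary D & Q w m0]])
    <= 2 ^+ (2 ^ q + 2 ^ q) * (9 / 10) ^+ (2 ^ j).
Proof.
rewrite -natrX -absent_m0; apply: Pr_sprinkle; [lia|lia|..].
- move=> G GE /andP[ns /ltnW iq].
  apply: (@leq_trans (2 ^ (#|isolated G| + 2 ^ (d - j)))%N); last first.
    by rewrite leq_exp2l // leq_add ?subKn.
  apply: leq_trans _ (leq_pexp2l _ (card_roots GE (leq_subr _ _) ns)) => //.
  apply: leq_trans (card_closed GE); apply: subset_leq_card.
  by apply/subsetP => D; rewrite !inE => /andP[].
- by move=> G D; rewrite inE => /andP[].
- move=> G D; rewrite inE => /and3P[_ jD Dd].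
  (* with at most half of the vertices, the average outer degree is at least 1 *)
  apply: leq_trans jD _.
  have := @isoperimetry _ D d.-1; have -> : (d - d.-1 = 1)%N by lia.
  rewrite muln1; apply.
  have e2 : (2 ^ d = 2 * 2 ^ d.-1)%N by rewrite -expnS prednK.
  by move: Dd; rewrite e2; lia.
Qed.

Lemma Pr_failure : cut_weight (d - 4) <= 1 -> cut_weight q <= 1 ->
  Pr R (fun w : trajectory d => tau_D w != tau_C w) <=
    17 * (2 ^+ d * cut_weight (d - 4) ^+ 2)
    + 2 * 2 ^+ d * (2 ^+ d * cut_weight q ^+ 16)
    + (5 / 4) ^+ d / 2 ^+ q
    + 2 ^+ (2 ^ q + 2 ^ q) * (9 / 10) ^+ (2 ^ j)
    + 2 / (17 / 16) ^+ d.
Proof.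
move=> w1 w2.
pose bad1 (w : trajectory d) := small_cut (2 ^ j) (Q w m1).
pose bad2 (w : trajectory d) := (2 ^ q <= #|isolated (Q w m1)|)%N.
pose bad3 (w : trajectory d) := good (Q w m1) &&
  [exists D, (D \in large_cuts (2 ^ j) (Q w m1))
    && [disjoint boundary D & Q w m0]].
pose bad4 (w : trajectory d) := isolated (Q w m0) == set0.
apply: (@le_trans _ _
    (Pr R (fun w => [|| bad1 w, bad2 w, bad3 w | bad4 w]))).
  apply: Pr_le => w wo.
  apply: contraNT; rewrite !negb_or => /and4P[b1 b2 b3 b4].
  have m10 : (m1 <= m0)%N by lia.
  apply: (tau_eq d0 wo m10 b1 _ b4) => D DF.
  apply: contra b3 => dis; rewrite /bad3 /good b1 ltnNge b2 /=.
  by apply/existsP; exists D; rewrite DF.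
rewrite -!addrA.
apply: le_trans (PrU _ _ _) _; rewrite addrA; apply: lerD.
  exact: Pr_small_cut.
apply: le_trans (PrU _ _ _) _; apply: lerD; first exact: Pr_isolated_m1.
apply: le_trans (PrU _ _ _) _; apply: lerD; first exact: Pr_large_cut.
(* 17/32 is a little less than the fraction 9/16 of edges absent at time m0,
   which leaves room for the d edges of a star *)
have -> : 17 / 16 = 2 * (17 / 32) :> R by field.
apply: Pr_no_isolated => //; [lia|lra|].
have : (17 * N <= 32 * (N - m0 - d))%N by lia.
by rewrite -(ler_nat R) !natrM; lra.
Qed.
End Failure.

(** * Geometric decay of the bound *)

Section Decay.
Variable R : realType.
Local Open Scope ring_scope.

Lemma bernoulli (x : R) n : 0 <= x -> 1 + n%:R * x <= (1 + x) ^+ n.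
Proof.
move=> x0; elim: n => [|n IH]; first by rewrite mul0r addr0.
rewrite exprSr; apply: (@le_trans _ _ ((1 + n%:R * x) * (1 + x))).
  have : 0 <= n%:R * (x * x) by rewrite mulr_ge0 // mulr_ge0.
  by rewrite -natr1; lra.
by rewrite ler_wpM2r //; lra.
Qed.

Lemma expr_le_expr (x y : R) n : 0 <= x -> x <= y -> x ^+ n <= y ^+ n.
Proof. by move=> x0 xy; apply: lerXn2r; rewrite ?nnegrE // (le_trans x0). Qed.

Variables d q : nat.
Hypothesis dq : d = (3 * q + d %% 3)%N.

Let dl : (3 * q <= d)%N. Proof. by rewrite dq leq_addr. Qed.
Let du : (d <= 3 * q + 2)%N. Proof. by rewrite dq leq_add2l -ltnS ltn_pmod. Qed.

(** The base [21/20] is close enough to 1 for the polynomial factors [d^2] to be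
    absorbed by the geometric ones. *)
Lemma d_le_exp : d%:R <= 60 * (21 / 20) ^+ q :> R.
Proof.
have := @bernoulli (1 / 20) q ltac:(lra).
have -> : 1 + 1 / 20 = 21 / 20 :> R by field.
have : d%:R <= 3 * q%:R + 2 :> R by rewrite -natrM -natrD ler_nat.
lra.
Qed.

Lemma cut_weight_pow k (c : R) : (21 / 20) ^+ 2 * (5 / 8) ^+ k <= c ->
  (d ^ 2)%:R * ((5 / 8) ^+ k) ^+ q <= 3600 * c ^+ q.
Proof.
move=> kc.
have r0 n : 0 <= (5 / 8) ^+ n :> R by rewrite exprn_ge0 // divr_ge0.
apply: (@le_trans _ _ (3600 * ((21 / 20) ^+ 2 * (5 / 8) ^+ k) ^+ q)); last first.
  by rewrite ler_wpM2l // expr_le_expr // mulr_ge0 // exprn_ge0 // divr_ge0.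
rewrite [((_ ^+ 2) * _) ^+ q]exprMn mulrA.
apply: ler_wpM2r; first exact: exprn_ge0.
have := @expr_le_expr d%:R _ 2 (ler0n _ _) d_le_exp.
rewrite natrX [(60 * _) ^+ 2]exprMn (exprAC _ q 2); lra.
Qed.

Lemma cut_weight_q : cut_weight R d q <= 3600 * (7 / 10) ^+ q.
Proof. have := @cut_weight_pow 1 (7 / 10); rewrite expr1; apply; lra. Qed.

Lemma cut_weight_d4 :
  (4 <= d)%N -> cut_weight R d (d - 4) <= 23600 * (27 / 100) ^+ q.
Proof.
move=> d4; have := @cut_weight_pow 3 (27 / 100) ltac:(lra).
rewrite -exprM => le.
apply: (@le_trans _ _
    ((8 / 5) ^+ 4 * ((d ^ 2)%:R * (5 / 8) ^+ (3 * q)))); last first.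
  have : 0 <= (27 / 100) ^+ q :> R by rewrite exprn_ge0 // divr_ge0.
  move: le; set a := _ * _ ^+ (3 * q); set b := (27 / 100) ^+ q => le b0.
  apply: (@le_trans _ _ ((8 / 5) ^+ 4 * (3600 * b))); last by lra.
  by rewrite ler_wpM2l // exprn_ge0 // divr_ge0.
rewrite mulrCA ler_wpM2l //.
have : (5 / 8) ^+ (d - 4) * (5 / 8) ^+ 4 <= (5 / 8) ^+ (3 * q) :> R.
  by rewrite -exprD subnK // ler_wiXn2l // ?divr_ge0 //; lra.
lra.
Qed.

(* of the bases of the terms below, 125/128 is the largest: it is that of
   (5/4)^d / 2^q *)
Let sigma : R := 125 / 128.

Lemma pow_sigma (c : R) : 0 <= c -> c <= sigma -> c ^+ q <= sigma ^+ q.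
Proof. exact: expr_le_expr. Qed.

Lemma pow2d : 2 ^+ d <= 4 * 8 ^+ q :> R.
Proof.
apply: (@le_trans _ _ (2 ^+ (3 * q + 2))); first by rewrite ler_weXn2l //; lra.
by rewrite exprD exprM (_ : 2 ^+ 3 = 8); [lra|ring].
Qed.

Lemma tiny_cuts_decay K : 0 <= K ->
  cut_weight R d (d - 4) <= K * (27 / 100) ^+ q ->
  17 * (2 ^+ d * cut_weight R d (d - 4) ^+ 2) <= 17 * 4 * K ^+ 2 * sigma ^+ q.
Proof.
move=> K0 /(@expr_le_expr _ _ 2 (cut_weight_ge0 _ _ _)) le.
apply: (@le_trans _ _ (17 * (4 * 8 ^+ q * (K * (27 / 100) ^+ q) ^+ 2))).
  apply: ler_wpM2l => //; apply: ler_pM le; rewrite ?pow2d ?exprn_ge0 //.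
  exact: cut_weight_ge0.
rewrite [(K * _) ^+ 2]exprMn (exprAC _ q 2).
have -> : 17 * (4 * 8 ^+ q * (K ^+ 2 * ((27 / 100) ^+ 2) ^+ q)) =
   17 * 4 * K ^+ 2 * (8 * (27 / 100) ^+ 2) ^+ q.
  by rewrite [X in _ = _ * X]exprMn; ring.
apply: ler_wpM2l; first by rewrite !mulr_ge0 ?exprn_ge0.
by apply: pow_sigma; rewrite /sigma; lra.
Qed.

Lemma small_cuts_decay K : 0 <= K ->
  cut_weight R d q <= K * (7 / 10) ^+ q ->
  2 * 2 ^+ d * (2 ^+ d * cut_weight R d q ^+ 16)
    <= 2 * 4 ^+ 2 * K ^+ 16 * sigma ^+ q.
Proof.
move=> K0 /(@expr_le_expr _ _ 16 (cut_weight_ge0 _ _ _)) le.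
have w0 : 0 <= cut_weight R d q ^+ 16 by exact/exprn_ge0/cut_weight_ge0.
have p0 : 0 <= 2 ^+ d :> R by exact: exprn_ge0.
apply: (@le_trans _ _
    (2 * (4 * 8 ^+ q) * (4 * 8 ^+ q * (K * (7 / 10) ^+ q) ^+ 16))).
  apply: ler_pM; [exact: mulr_ge0|exact: mulr_ge0|..].
    by rewrite ler_wpM2l // pow2d.
  by apply: ler_pM le => //; exact: pow2d.
rewrite [(K * _) ^+ 16]exprMn (exprAC _ q 16).
have -> : 2 * (4 * 8 ^+ q) * (4 * 8 ^+ q * (K ^+ 16 * ((7 / 10) ^+ 16) ^+ q)) =
   2 * 4 ^+ 2 * K ^+ 16 * (64 * (7 / 10) ^+ 16) ^+ q.
  have -> : 64 = 8 * 8 :> R by lra.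
  by rewrite [X in _ = _ * X]exprMn [(8 * 8) ^+ q]exprMn; ring.
apply: ler_wpM2l; first by rewrite !mulr_ge0 ?exprn_ge0.
by apply: pow_sigma; rewrite /sigma; lra.
Qed.

Lemma isolated_decay : (5 / 4) ^+ d / 2 ^+ q <= (5 / 4) ^+ 2 * sigma ^+ q.
Proof.
have p2 : 0 < 2 ^+ q :> R by rewrite exprn_gt0.
rewrite ler_pdivrMr // -mulrA -exprMn.
apply: (@le_trans _ _ ((5 / 4) ^+ (3 * q + 2))).
  by rewrite ler_weXn2l //; lra.
rewrite exprD exprM mulrC; apply: ler_wpM2l.
  by rewrite exprn_ge0 // divr_ge0.
by apply: expr_le_expr; rewrite /sigma; lra.
Qed.

Lemma large_cuts_decay : (5 <= q)%N ->
  2 ^+ (2 ^ q + 2 ^ q) * (9 / 10) ^+ (2 ^ (d - q)) <= sigma ^+ q.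
Proof.
move=> q5.
have r0 n : 0 <= (9 / 10) ^+ n :> R by rewrite exprn_ge0 // divr_ge0.
apply: (@le_trans _ _ (2 ^+ (2 ^ q + 2 ^ q) * (9 / 10) ^+ (2 ^ q * 2 ^ q))).
  rewrite ler_wpM2l ?exprn_ge0 // ler_wiXn2l ?divr_ge0 //; first by lra.
  by rewrite -expnD leq_exp2l //; have := dl; lia.
rewrite addnn -mul2n exprM [in X in _ * X]exprM -exprMn.
have half : 2 ^+ 2 * (9 / 10) ^+ (2 ^ q) <= 1 / 2 :> R.
  have : (9 / 10) ^+ (2 ^ q) <= (9 / 10) ^+ 32 :> R.
    by rewrite ler_wiXn2l ?divr_ge0 //; [lra|rewrite (@leq_exp2l 2 5 q)].
  by lra.
apply: (@le_trans _ _ ((1 / 2) ^+ (2 ^ q))).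
  by apply: expr_le_expr => //; rewrite mulr_ge0 ?exprn_ge0 ?divr_ge0.
apply: (@le_trans _ _ ((1 / 2) ^+ q)).
  by rewrite ler_wiXn2l ?divr_ge0 //; [lra|exact/ltnW/ltn_expl].
by apply: pow_sigma; rewrite /sigma; lra.
Qed.

Lemma no_isolated_decay : 2 / (17 / 16) ^+ d <= 2 * sigma ^+ q.
Proof.
rewrite ler_wpM2l // -exprVn; apply: (@le_trans _ _ ((17 / 16)^-1 ^+ q)).
  by rewrite ler_wiXn2l ?invr_ge0 //; [lra|lra|have := dl; lia].
by apply: pow_sigma; rewrite /sigma; lra.
Qed.
End Decay.

Section FailureDecay.
Variable R : realType.
Local Open Scope ring_scope.

Lemma failure_decay : exists C : R, forall d, (90 <= d)%N ->
  Pr R (fun w : trajectory d => tau_D w != tau_C w)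
    <= C * (125 / 128) ^+ (d %/ 3).
Proof.
have [K1 [K10 k1]] : exists K : R, 0 <= K /\ forall d q,
    d = (3 * q + d %% 3)%N -> (4 <= d)%N ->
    cut_weight R d (d - 4) <= K * (27 / 100) ^+ q.
  by exists 23600; split=> // d q; exact: cut_weight_d4.
have [K2 [K20 k2]] : exists K : R, 0 <= K /\ forall d q,
    d = (3 * q + d %% 3)%N -> cut_weight R d q <= K * (7 / 10) ^+ q.
  by exists 3600; split=> // d q; exact: cut_weight_q.
exists (17 * 4 * K1 ^+ 2 + 2 * 4 ^+ 2 * K2 ^+ 16 + (5 / 4) ^+ 2 + 1 + 2).
move=> d d90; have dq : d = (3 * (d %/ 3) + d %% 3)%N by lia.
have q30 : (30 <= d %/ 3)%N by lia.
have q5 : (5 <= d %/ 3)%N by lia.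
have d4 : (4 <= d)%N by lia.
have small (c : R) :
    0 <= c -> c <= 7 / 10 -> c ^+ (d %/ 3) <= (7 / 10) ^+ 30.
  move=> c0 c7; apply: (@le_trans _ _ ((7 / 10) ^+ (d %/ 3))).
    exact: expr_le_expr.
  by rewrite ler_wiXn2l //; lra.
(* 30 makes 23600 (7/10)^30 at most 1 *)
have w1 : cut_weight R d (d - 4) <= 1.
  apply: le_trans (cut_weight_d4 R dq d4) _.
  by have := small (27 / 100) ltac:(lra) ltac:(lra); lra.
have w2 : cut_weight R d (d %/ 3) <= 1.
  apply: le_trans (cut_weight_q R dq) _.
  by have := small (7 / 10) ltac:(lra) ltac:(lra); lra.
have NL : nsteps d = (16 * (2 ^ (d - 5) * d))%N.
  have -> : nsteps d = (2 ^ (d - 5) * 32 * d %/ 2)%N.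
    by rewrite -(expnD 2 (d - 5) 5) subnK //; lia.
  by lia.
have dL : (2 * d <= 2 ^ (d - 5) * d)%N.
  rewrite leq_mul2r; apply/orP; right.
  by rewrite -{1}(expn1 2) leq_exp2l //; lia.
apply: le_trans
  (@Pr_failure R d (d %/ 3) _ ltac:(lia) ltac:(lia) NL dL w1 w2) _.
set s : R := (125 / 128) ^+ (d %/ 3).
have -> : (17 * 4 * K1 ^+ 2 + 2 * 4 ^+ 2 * K2 ^+ 16 + (5 / 4) ^+ 2 + 1 + 2) * s
    = 17 * 4 * K1 ^+ 2 * s + 2 * 4 ^+ 2 * K2 ^+ 16 * s + (5 / 4) ^+ 2 * s + s
      + 2 * s by ring.
apply: lerD _ (no_isolated_decay R dq).
apply: lerD _ (large_cuts_decay R dq q5).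
apply: lerD _ (isolated_decay R dq).
exact: lerD (tiny_cuts_decay dq K10 (k1 _ _ dq d4))
            (small_cuts_decay dq K20 (k2 _ _ dq)).
Qed.
End FailureDecay.

(** * The limit *)

From mathcomp Require Import classical_sets reals topology normedtype sequences.
Import numFieldNormedType.Exports.

Lemma cvg_divn3 : ((fun d => (d %/ 3)%N) @ \oo --> \oo)%classic.
Proof.
apply/cvgnyPge => A; near=> d.
by rewrite leq_divRL //; near: d; exact: nbhs_infty_ge.
Unshelve. all: by end_near. Qed.

Theorem theorem1 (R : realType) :
  ((fun d : nat => Pr R (fun w : trajectory d => tau_D w == tau_C w))
     @ \oo --> (1 : R))%classic%R.
Proof.
Local Open Scope ring_scope.
have [C fail] := failure_decay R.
have s1 : `|125 / 128 : R| < 1 by rewrite ger0_norm ?divr_ge0 //; lra.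
have cv : ((fun d => 1 - C * (125 / 128 : R) ^+ (d %/ 3)) @ \oo
    --> (1 : R))%classic.
  rewrite -[X in (_ --> X)%classic](subr0 1) -[X in 1 - X](mulr0 C).
  apply: cvgB; first exact: cvg_cst.
  apply: cvgMr; exact: (cvg_comp _ _ cvg_divn3 (cvg_expr s1)).
apply: squeeze_cvgr cv (cvg_cst _); near=> d.
have d90 : (90 <= d)%N by near: d; exact: nbhs_infty_ge.
rewrite Pr_compl; have le := fail d d90.
by apply/andP; split; [rewrite lerD2l lerN2|rewrite gerBl Pr_ge0].
Unshelve. all: by end_near. Qed.
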